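(* Let $\mathcal{P}_4$ be the set of partitions $\lambda=(\lambda_1>\cdots>\lambda_\ell)$ into distinct positive parts such that for each $1\le i<\ell$: $\lambda_i-\lambda_{i+1}\equiv2\pmod 4$ if both are odd; $\equiv0\pmod 4$ if both are even; $\equiv3\pmod 4$ if they have different parity; and the smallest part $\lambda_\ell\equiv1$ or $2\pmod 4$ (empty partition included). Then $$\sum_{\lambda\in\mathcal{P}_4}(-1)^{e(\lambda)}q^{|\lambda|}=\sum_{n=0}^{\infty}\frac{(q;q^2)_{n}q^{n^{2}}}{(q^4;q^4)_{n}}=\frac{(q^2;q^4)_{\infty}^2}{(q;q^2)_{\infty}}.$$
   Context: $e(\lambda)$ is the number of even parts of $\lambda$, $|\lambda|$ the sum of its parts, $(a;q)_n=\prod_{i=0}^{n-1}(1-aq^i)$ for $n\in\mathbb{Z}_{\ge0}\cup\{\infty\}$, $|q|<1$. *)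

(* Defs.v *)
From HB Require Import structures.
From mathcomp Require Import all_boot all_order all_algebra.
From mathcomp Require Import finmap complex.
From mathcomp Require Import all_classical all_reals all_analysis.
From mathcomp Require Import summability.

Set Implicit Arguments.
Unset Strict Implicit.
Unset Printing Implicit Defensive.

Import Order.TTheory GRing.Theory Num.Theory.
Import numFieldNormedType.Exports.

Local Open Scope classical_set_scope.

(* A partition into distinct parts is the strictly decreasing list of its
   (positive) parts. *)
Definition distinct_partition (l : seq nat) : bool :=
  sorted gtn l && (0 \notin l).

(* The subtraction is truncated; [gap4 a b] is only meaningful for b <= a. *)
Definition gap4 (a b : nat) : bool :=
  if odd a (+) odd b then a - b == 3 %[mod 4]
  else if odd a then a - b == 2 %[mod 4]
  else a - b == 0 %[mod 4].

Definition P4 (l : seq nat) : bool :=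
  [&& distinct_partition l, sorted gap4 l &
      (l == [::]) || (last 0 l %% 4 \in [:: 1; 2])].

Definition even_parts (l : seq nat) : nat := count (fun x => ~~ odd x) l.

Local Open Scope ring_scope.

Definition qpoch (K : pzRingType) (a q : K) (n : nat) : K :=
  \prod_(i < n) (1 - a * q ^+ i).

Definition qpoch_inf (K : numFieldType) (a q : K) : K :=
  limn (qpoch a q : nat -> K).

Definition series_to (K : numFieldType) (u : nat -> K) (s : K) : Prop :=
  series u @ \oo --> s.

(* Unordered (equivalently, in R or C, absolutely convergent) summation: the
   finite partial sums converge along the filter of finite subsets of I. *)
Definition sums_to (K : numFieldType) (I : choiceType) (x : I -> K) (s : K) :
    Prop :=
  partial_sum x @ totally --> s.

(* Main.v *)
Require Import Defs.
From mathcomp Require Import all_boot all_order all_algebra finmap complex.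
From mathcomp Require Import all_classical all_reals all_analysis.
From mathcomp Require Import summability.
From mathcomp Require Import zify ring.

(** Reading a partition of P4 from its smallest part upwards, the residue mod 4
    of each part is determined by its parity and by the parts below it. Removing
    the smallest part w + 4 m, with w = 1 (odd) or 2 (even), and subtracting
    2 w + 4 m from all the others leaves an arbitrary partition of P4, so the
    partitions with n parts correspond to n free choices of (w, m); the j-th
    choice contributes q^((2j-1) w + 4 j m) and the sign (-1)^(w-1). Summing,
    P4 with n parts has generating function
      prod_(j <= n) q^(2j-1) (1 - q^(2j-1)) / (1 - q^(4j)),
    the n-th term of the series. The series is the limit N -> oo of a
    terminating 2phi1 in base q^2 evaluated by the q-Chu-Vandermonde sum. Both
    limits are exchanged with the sums by dominated convergence (Tannery), the
    terms being O(|q|^n). *)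

Set Implicit Arguments.
Unset Strict Implicit.
Unset Printing Implicit Defensive.

Import Order.TTheory GRing.Theory Num.Theory numFieldNormedType.Exports.

Local Open Scope classical_set_scope.
Local Open Scope ring_scope.

(** * The terminating identity *)

Section QPochhammer.
Variable K : fieldType.
Implicit Types a p q z : K.

Lemma qpoch0 a p : qpoch a p 0 = 1.
Proof. by rewrite /qpoch big_ord0. Qed.

Lemma qpochS a p n : qpoch a p n.+1 = qpoch a p n * (1 - a * p ^+ n).
Proof. by rewrite /qpoch big_ord_recr. Qed.

Lemma qpochSl a p n : qpoch a p n.+1 = (1 - a) * qpoch (a * p) p n.
Proof.
rewrite /qpoch big_ord_recl expr0 mulr1; congr (_ * _).
by apply: eq_bigr => i _; rewrite /= /bump /= exprS mulrA.
Qed.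

Lemma qpoch_neq0 a p n : (forall i, 1 - a * p ^+ i != 0) -> qpoch a p n != 0.
Proof. by move=> h; apply/prodf_neq0 => i _. Qed.

Lemma qpochN a p n : qpoch a p n * qpoch (- a) p n = qpoch (a ^+ 2) (p ^+ 2) n.
Proof.
by rewrite /qpoch -big_split; apply: eq_bigr => i _ /=; rewrite exprAC; ring.
Qed.

(** The factors 1 - p^i with 1 <= i <= 2n are split by the parity of i. *)
Lemma qpoch_double p n :
  qpoch p p n.*2 = qpoch p (p ^+ 2) n * qpoch (p ^+ 2) (p ^+ 2) n.
Proof.
elim: n => [|n IH]; first by rewrite !qpoch0 mulr1.
rewrite doubleS !qpochS IH -!exprM -!exprS -exprD mul2n add2n.
by ring.
Qed.

(* q-Chu-Vandermonde with parameters q^{-N}, a; c = a z, written without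
   negative powers of p. *)
Lemma qGauss_finite p z N : (forall i, 1 - p ^+ i.+1 != 0) ->
  forall a, (forall i, 1 - a * z * p ^+ i != 0) ->
  \sum_(n < N.+1) qpoch a p n * (- z) ^+ n * p ^+ 'C(n, 2)
     / (qpoch p p n * qpoch p p (N - n) * qpoch (a * z) p n)
  = qpoch z p N / (qpoch (a * z) p N * qpoch p p N).
Proof.
move=> hp.
have P0 n : qpoch p p n != 0.
  by apply: qpoch_neq0 => i; rewrite -exprS; exact: hp.
elim: N => [|N IH] a ha.
  by rewrite big_ord_recl big_ord0 !qpoch0 /= !expr0 !mulr1 addr0.
have ha' i : 1 - a * p * z * p ^+ i != 0.
  by move: (ha i.+1); rewrite exprS !mulrA -(mulrA a z) (mulrC z) mulrA.
have Q0 n : qpoch (a * z) p n != 0 by exact: qpoch_neq0.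
have Q0' n : qpoch (a * p * z) p n != 0 by exact: qpoch_neq0.
have az0 : 1 - a * z != 0 by move: (ha 0%N); rewrite expr0 mulr1.
have E : qpoch (a * z) p N * (1 - a * z * p ^+ N)
         = (1 - a * z) * qpoch (a * p * z) p N.
  by rewrite -qpochS qpochSl -!mulrA (mulrC z).
pose F n : K := qpoch a p n * (- z) ^+ n * p ^+ 'C(n, 2)
  / (qpoch p p n * qpoch p p (N.+1 - n) * qpoch (a * z) p n).
rewrite -[LHS]/(\sum_(n < N.+2) F n).
(* The first term cancels the last factor of (p;p)_(N+1-n), leaving the case N for the same [a]. The
   second cancels the last factor of (p;p)_n and, after n -> n+1, leaves the case N for [a * p];
   hence the induction over all [a]. *)
have EF (n : 'I_N.+2) :
    (1 - p ^+ N.+1) * F n = (1 - p ^+ (N.+1 - n)) * F n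
                            + p ^+ (N.+1 - n) * (1 - p ^+ n) * F n.
  by rewrite -{1}(subnK (ltnSE (ltn_ord n))) exprD; ring.
apply: (mulfI (hp N)); rewrite mulr_sumr (eq_bigr _ (fun n _ => EF n)) big_split /=.
rewrite big_ord_recr /= subnn subrr mul0r addr0.
rewrite [X in _ + X]big_ord_recl /= subrr mulr0 mul0r add0r.
rewrite (_ : \sum_(i < _) _ = qpoch z p N / (qpoch (a * z) p N * qpoch p p N)).
  rewrite (_ : \sum_(i < _) _ = (- z * p ^+ N * (1 - a) / (1 - a * z)) *
    (qpoch z p N / (qpoch (a * p * z) p N * qpoch p p N))).
    rewrite (_ : qpoch (a * p * z) p N
                 = qpoch (a * z) p N * (1 - a * z * p ^+ N) / (1 - a * z)).
      rewrite !qpochS -exprS; field.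
      by rewrite hp ha Q0 P0 az0.
    by rewrite E; field.
  rewrite -IH // mulr_sumr; apply: eq_bigr => i _.
  rewrite /F /= /bump /= add1n subSS binS bin1 !exprS qpochSl.
  rewrite (qpochSl (a * z)) (_ : a * z * p = a * p * z); last by ring.
  rewrite (qpochS p p i) exprD.
  have -> : p ^+ N = p ^+ (N - i) * p ^+ i by rewrite -exprD subnK // -ltnS.
  by field; rewrite -exprS hp !P0 Q0' az0.
rewrite -IH //; apply: eq_bigr => i _.
rewrite /F /= subSn ?qpochS -?exprS; last exact: (ltnSE (ltn_ord i)).
by field; rewrite hp !P0 Q0.
Qed.

(** Take p = q^2, a = q, z = -q, so that a z = -q^2. The product of (x;q^2)_n and (-x;q^2)_n is
    (x^2;q^4)_n, used for x = q and x = q^2. *)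
Lemma lebesgue_identity_finite q N : (forall i, 1 - q ^+ i.+1 != 0) ->
  (forall i, 1 + q ^+ i.+1 != 0) ->
  \sum_(n < N.+1) qpoch q (q ^+ 2) n * q ^+ (n ^ 2)
     / qpoch (q ^+ 4) (q ^+ 4) n / qpoch (q ^+ 2) (q ^+ 2) (N - n)
  = qpoch (q ^+ 2) (q ^+ 4) N / (qpoch q (q ^+ 2) N * qpoch (q ^+ 4) (q ^+ 4) N).
Proof.
move=> hm hp.
have m0 i : 1 - q * (q ^+ 2) ^+ i != 0 by rewrite -exprM -exprS.
have hp' i : 1 - q * - q * (q ^+ 2) ^+ i != 0.
  by rewrite mulrN mulNr opprK -expr2 -exprM -exprD add2n.
have := @qGauss_finite (q ^+ 2) (- q) N _ q hp'.
have -> : q * - q = - q ^+ 2 by ring.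
move=> h; transitivity (qpoch (- q) (q ^+ 2) N /
  (qpoch (- q ^+ 2) (q ^+ 2) N * qpoch (q ^+ 2) (q ^+ 2) N)).
  rewrite -h; last by move=> i; rewrite -exprM mulnS add2n.
  apply: eq_bigr => n _; rewrite opprK -exprM.
  rewrite -(mulrA _ (q ^+ n)) -exprD.
  have -> : (n + 2 * 'C(n, 2) = n ^ 2)%N.
    by elim: (nat_of_ord n) => // k; rewrite binS bin1; lia.
  have := qpochN (q ^+ 2) (q ^+ 2) n; rewrite -!exprM /= => <-.
  by rewrite -!mulrA; congr (_ * (_ * _)); rewrite !invfM; ring.
have := qpochN (q ^+ 2) (q ^+ 2) N; rewrite -!exprM /= => <-.
have := qpochN q (q ^+ 2) N; rewrite -!exprM /= => <-.
have Q0 : qpoch q (q ^+ 2) N != 0 by exact: qpoch_neq0.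
have Q1 : qpoch (- q ^+ 2) (q ^+ 2) N != 0.
  by apply: qpoch_neq0 => i; rewrite mulNr opprK -exprM -exprD add2n.
have Q2 : qpoch (q ^+ 2) (q ^+ 2) N != 0.
  by apply: qpoch_neq0 => i; rewrite -exprM -exprD add2n.
by field; rewrite Q0 Q1 Q2.
Qed.

End QPochhammer.

(** * Enumeration of P4 *)

(** Joining strict descent to the gap condition keeps the subtraction in [gap4] from being truncated
    and gives one relation, invariant under even shifts. *)
Definition R4 (a b : nat) : bool := (b < a)%N && gap4 a b.

Lemma sorted_R4 l : sorted R4 l = sorted gtn l && sorted gap4 l.
Proof.
case: l => //= a l; elim: l a => //= b l IH a.
by rewrite IH /R4 /= andbACA.
Qed.

Lemma sorted_R4_min l x : sorted R4 l -> x \in l -> (last 0 l <= x)%N.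
Proof.
case: l => //= a l; elim: l a x => [|b l IH] a x /=.
  by rewrite inE => _ /eqP ->.
case/andP => /andP[ba _] pl; rewrite inE => /predU1P[->|]; last exact: IH.
by apply: leq_trans (ltnW ba); apply: IH; rewrite // mem_head.
Qed.

(** A zero part would be the last one, as the last part is minimal, and its residue mod 4 would be
    neither 1 nor 2. *)
Lemma P4E l :
  P4 l = sorted R4 l && ((l == [::]) || (last 0 l %% 4 \in [:: 1; 2]))%N.
Proof.
rewrite /P4 /distinct_partition sorted_R4 -!andbA.
case s1: (sorted gtn l) => //=; case s2: (sorted gap4 l); rewrite /= ?andbF //.
case: eqP => [-> //|/= l0]; case h: (_ \in [:: _; _]); rewrite ?andbF // andbT.
apply/negP => /(sorted_R4_min _).
by rewrite sorted_R4 s1 s2 leqn0 => /(_ isT)/eqP l00; move: h; rewrite l00.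
Qed.

Lemma sorted_rcons_last (r : rel nat) l x : sorted r (rcons l x) =
  sorted r l && ((l == [::]) || r (last 0%N l) x).
Proof. by case: l => //= a l; rewrite rcons_path. Qed.

Lemma P4_rcons l x : P4 (rcons l x) =
  [&& (x %% 4 \in [:: 1; 2])%N, sorted R4 l & (l == [::]) || R4 (last 0%N l) x].
Proof.
rewrite P4E sorted_rcons_last last_rcons andbC.
by rewrite (_ : rcons l x == [::] = false) //; case: l.
Qed.

(* The new smallest part is w + 4 m with w = 1 or 2 (as c.1 is false or true);
   the shift of the other parts makes the gap w' + w, where w' is the residue of
   the previous smallest part. *)
Definition shift4 (c : bool * nat) : nat := (2 * c.1.+1 + 4 * c.2)%N.
Definition grow (c : bool * nat) (l : seq nat) : seq nat :=
  rcons [seq (y + shift4 c)%N | y <- l] (c.1.+1 + 4 * c.2)%N.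

Lemma gap4_shift k a b : ~~ odd k -> gap4 (a + k) (b + k) = gap4 a b.
Proof. by move=> /negPf k2; rewrite /gap4 subnDr !oddD k2 !addbF. Qed.

Lemma sorted_R4_shift k l : ~~ odd k ->
  sorted R4 [seq (y + k)%N | y <- l] = sorted R4 l.
Proof.
move=> k2; rewrite sorted_map; apply: eq_sorted => a b /=.
by rewrite /R4 gap4_shift // ltn_add2r.
Qed.

Lemma odd_shift4 c : odd (shift4 c) = false.
Proof. by rewrite /shift4 oddD !oddM. Qed.

Lemma last_map_nat (f : nat -> nat) l :
  l != [::] -> last 0%N (map f l) = f (last 0%N l).
Proof. by case: l => //= a l _; rewrite last_map. Qed.

(** With w and w' in {1, 2}, the new gap is w' + w mod 4: 2 for two odd parts, 0 for two even ones,
    3 for mixed parity, as [gap4] demands. *)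
Lemma P4_grow c l : P4 l -> P4 (grow c l).
Proof.
rewrite P4E P4_rcons sorted_R4_shift ?odd_shift4 // => /andP[-> h].
apply/and3P; split => //; first by case: c => -[] m; rewrite !inE /=; lia.
have [->//|l0] := eqVneq l [::].
move: h; rewrite (negPf l0) last_map_nat //= => h; apply/orP; right.
move: (last 0%N l) h => y; rewrite !inE /R4 /gap4 /shift4 -oddD.
by case: c => -[] m /=; case: ifP; [|case: ifP| |case: ifP]; lia.
Qed.

Lemma P4_rcons_grow l x : P4 (rcons l x) ->
  exists c l', P4 l' /\ rcons l x = grow c l'.
Proof.
rewrite P4_rcons => /and3P[hx sl hl].
pose c : bool * nat := ((x %% 4 == 2)%N, (x %/ 4)%N).
pose l' := [seq (y - shift4 c)%N | y <- l].
have xE : x = (c.1.+1 + 4 * c.2)%N.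
  by move: hx; rewrite !inE /c /=; lia.
(* With y the last part of [l], y - [shift4 c] = (y - x) - w. The gap y - x is positive and
   congruent to 2, 0 or 3 mod 4, hence at least 2, 4 or 3; so the difference is positive with
   residue 1 or 2. *)
have hlast : l != [::] ->
    [&& shift4 c < last 0 l & (last 0 l - shift4 c) %% 4 \in [:: 1; 2]]%N.
  move=> l0; move: hl; rewrite (negPf l0) /= => h.
  move: (last 0%N l) h => y; rewrite !inE /R4 /gap4 /shift4 xE -oddD.
  by move: c {l' xE} => [[] m] /=; case: ifP; [|case: ifP| |case: ifP]; lia.
have lE : l = [seq (y + shift4 c)%N | y <- l'].
  rewrite -map_comp -[LHS]map_id; apply/eq_in_map => y yl /=.
  rewrite subnK //; have /hlast/andP[h _] : l != [::] by case: (l) yl.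
  exact: leq_trans (ltnW h) (sorted_R4_min sl yl).
exists c, l'; split; last by rewrite /grow -lE -xE.
rewrite P4E -(sorted_R4_shift (k := shift4 c)) ?odd_shift4 // -lE sl /=.
have [->|l0] := eqVneq l' [::]; first by [].
have l0' : l != [::] by move: l0; rewrite /l'; case: (l).
by have /andP[_] := hlast l0'; rewrite /l' last_map_nat.
Qed.

(** The last entry w + 4 m determines w, its residue mod 4, and m, hence also the shift. *)
Lemma grow_inj c c' l l' : grow c l = grow c' l' -> c = c' /\ l = l'.
Proof.
move=> /rcons_inj[h e]; have cc : c = c'.
  by move: e; case: c {h} => [[] m]; case: c' => [[] m'] /=; (try lia) => e; congr (_, _); lia.
by split=> //; move: h; rewrite cc; apply: inj_map => a b; apply: addIn.
Qed.

Definition codes (M : nat) : seq (bool * nat) :=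
  [seq (b, m) | b <- [:: false; true], m <- iota 0 M].

(** The cutoff m < M on each of the n choices makes the list finite; as M grows, the lists exhaust
    the n-part members of P4. *)
Fixpoint enum4 (M n : nat) : seq (seq nat) :=
  if n is n'.+1 then [seq grow c l | c <- codes M, l <- enum4 M n']
  else [:: [::]].

Lemma codesP M c : (c \in codes M) = (c.2 < M)%N.
Proof.
apply/allpairsP/idP => [[[b m] [_ /= mM ->]]|cM].
  by rewrite mem_iota in mM.
by exists c; rewrite mem_iota cM /= !inE; case: c {cM} => [[] m].
Qed.

Lemma enum4_P4 M n l : l \in enum4 M n -> P4 l.
Proof.
elim: n l => [|n IH] l /=; first by rewrite inE => /eqP ->.
by case/allpairsP => -[c l'] /= [_ /IH h ->]; exact: P4_grow.
Qed.

Lemma enum4_size M n l : l \in enum4 M n -> size l = n.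
Proof.
elim: n l => [|n IH] l /=; first by rewrite inE => /eqP ->.
by case/allpairsP => -[c l'] /= [_ /IH h ->]; rewrite size_rcons size_map h.
Qed.

Lemma enum4_mono M M' n : (M <= M')%N -> {subset enum4 M n <= enum4 M' n}.
Proof.
move=> MM'; elim: n => [//|n IH] l /allpairsP[[c l'] /= [cM /IH h ->]].
by apply: allpairs_f => //; move: cM; rewrite !codesP => /leq_trans; apply.
Qed.

Lemma enum4_exhaust l : P4 l -> exists M, l \in enum4 M (size l).
Proof.
have [n] := ubnP (size l); elim: n l => // n IH l.
case/lastP: l => [|l x]; first by exists 0%N; rewrite inE.
move=> sl /P4_rcons_grow[c [l' [hl' E]]].
have sE : size (rcons l x) = (size l').+1 by rewrite E size_rcons size_map.
have [|M hM] := IH l' _ hl'; first by move: sl; rewrite sE.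
exists (maxn M c.2.+1); rewrite sE E /=; apply: allpairs_f.
  by rewrite codesP leq_max ltnSn orbT.
exact: enum4_mono (leq_maxl _ _) _ hM.
Qed.

Lemma enum4_uniq M n : uniq (enum4 M n).
Proof.
elim: n => //= n IH; apply: allpairs_uniq => //.
  by apply: allpairs_uniq; rewrite ?iota_uniq // => -[? ?] [? ?].
by move=> [c l] [c' l'] _ _ /= /grow_inj[-> ->].
Qed.

(** A single cutoff bounds both the number of parts and every m, so one increasing sequence of
    finite sets exhausts P4. *)
Definition box4 (M : nat) : seq (seq nat) :=
  flatten [seq enum4 M n | n <- iota 0 M].

Lemma box4P M l : l \in box4 M = (size l < M)%N && (l \in enum4 M (size l)).
Proof.
apply/flatten_mapP/andP => [[n]|[lM h]].
  by rewrite mem_iota => /andP[_ nM] h; rewrite (enum4_size h).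
by exists (size l); rewrite // mem_iota.
Qed.

Lemma box4_uniq M : uniq (box4 M).
Proof.
have: uniq (iota 0 M) by exact: iota_uniq.
rewrite /box4; elim: (iota 0 M) => //= n s IH /andP[ns us].
rewrite cat_uniq enum4_uniq IH // andbT; apply/hasPn => l /flatten_mapP[m ms].
move=> /enum4_size sl; apply/negP => /enum4_size sl'.
by move: ns; rewrite -sl' sl ms.
Qed.

Lemma box4_mono M M' : (M <= M')%N -> {subset box4 M <= box4 M'}.
Proof.
move=> MM' l; rewrite !box4P => /andP[h /(enum4_mono MM') ->].
by rewrite (leq_trans h).
Qed.

Lemma box4_P4 M : all P4 (box4 M).
Proof. by apply/allP => l; rewrite box4P => /andP[_ /enum4_P4]. Qed.

Lemma box4_exhaust l : P4 l -> exists M, l \in box4 M.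
Proof.
move=> /enum4_exhaust[M h]; exists (maxn M (size l).+1).
by rewrite box4P leq_max ltnSn orbT (enum4_mono (leq_maxl _ _) h).
Qed.

(** * Generating function of the truncated enumeration *)

Section EnumSum.
Variable K : comNzRingType.
Implicit Types s q : K.

(** The sign is a variable: s = -1 gives the signed sum, while s = 1 at |q| gives the sum of
    absolute values. *)
Lemma enum4_sum s q M n :
  \sum_(l <- enum4 M n) s ^+ even_parts l * q ^+ sumn l =
  \prod_(j < n) (q ^+ j.*2.+1 * (1 + s * q ^+ j.*2.+1)
                 * \sum_(m < M) (q ^+ (4 * j.+1)) ^+ m).
Proof.
elim: n => [|n IH]; first by rewrite big_seq1 big_ord0 mulr1.
rewrite big_ord_recr /= -IH big_allpairs_dep /=.
(* Growing raises n parts by 2 w + 4 m and adds the part w + 4 m, in total (2n+1) w + 4 (n+1) m. The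
   shift is even, so only the new part can add to [even_parts]. *)
transitivity (\sum_(c <- codes M) (\sum_(l <- enum4 M n)
    s ^+ even_parts l * q ^+ sumn l) *
    (s ^+ c.1 * q ^+ (n.*2.+1 * c.1.+1 + 4 * n.+1 * c.2))).
  apply: eq_bigr => c _; rewrite mulr_suml big_seq [RHS]big_seq.
  apply: eq_bigr => l /enum4_size sl.
  rewrite mulrACA -!exprD /grow /even_parts -cats1 count_cat sumn_cat /= !addn0.
  congr (_ ^+ (_ + _) * _ ^+ _).
  - by rewrite count_map; apply: eq_count => y /=; rewrite oddD odd_shift4 addbF.
  - by case: c => -[] m /=; rewrite oddD oddM.
  - have -> : sumn [seq (y + shift4 c)%N | y <- l] = (sumn l + size l * shift4 c)%N.
      by elim: (l) => //= y l' ->; rewrite mulSn; lia.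
    by rewrite sl /shift4; lia.
rewrite -mulr_sumr; congr (_ * _).
rewrite big_allpairs_dep /= big_cons big_seq1 /=.
have -> : iota 0 M = index_iota 0 M by rewrite /index_iota subn0.
rewrite !big_mkord mulr_sumr -big_split; apply: eq_bigr => m _ /=.
move: (4 * n.+1)%N n.*2.+1 => k N.
rewrite !exprD muln1 !(exprM q) expr0 expr1.
by move: (q ^+ N) ((q ^+ k) ^+ m) => u v; ring.
Qed.

End EnumSum.

(** * Unordered sums *)

Section UnorderedSum.
Variables (K : numFieldType) (I : choiceType).

Lemma partial_sumE (x : I -> K) (A : {fset I}) :
  partial_sum x A = \sum_(i <- enum_fset A) x i.
Proof. by rewrite /partial_sum big_seq_fsetE. Qed.

Lemma ler_norm_sum_diff (x : I -> K) (s t u : seq I) :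
  uniq s -> uniq t -> uniq u -> {subset s <= t} -> {subset t <= u} ->
  `|\sum_(i <- t) x i - \sum_(i <- s) x i|
     <= \sum_(i <- u) `|x i| - \sum_(i <- s) `|x i|.
Proof.
move=> us ut uu st tu.
have split (y : I -> K) (a b : seq I) : uniq a -> uniq b -> {subset a <= b} ->
    \sum_(i <- b) y i = \sum_(i <- a) y i + \sum_(i <- b | i \notin a) y i.
  move=> ua ub ab; rewrite (bigID (mem a)) /=; congr (_ + _).
  rewrite -big_filter; apply/perm_big/uniq_perm; rewrite ?filter_uniq //.
  by move=> i; rewrite mem_filter; case ia: (i \in a); rewrite //= ab.
have su : {subset s <= u} by move=> i /st/tu.
have addBK (a b : K) : a + b - a = b by ring.
rewrite (split x s t) // (split _ s u) // !addBK.
apply: le_trans (ler_norm_sum _ _ _) _.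
rewrite -[leLHS]big_filter -[leRHS]big_filter.
rewrite (split (fun i => `|x i|) [seq i <- t | i \notin s] [seq i <- u | i \notin s])
  ?filter_uniq // ?lerDl ?sumr_ge0 //.
by move=> i; rewrite !mem_filter => /andP[-> /tu ->].
Qed.

(** A finite A containing [s M] lies in some [s M'], so its sum differs from that over [s M] by at
    most the difference of two partial sums of absolute values. Both are within e/4 of [S'], and the
    sum over [s M] is within e/2 of [S]. *)
Lemma sums_to_exhaust (x : I -> K) (s : nat -> seq I) (S S' : K) :
  (forall M, uniq (s M)) ->
  (forall M M', (M <= M')%N -> {subset s M <= s M'}) ->
  (forall i, exists M, i \in s M) ->
  (\sum_(i <- s M) x i) @[M --> \oo] --> S ->
  (\sum_(i <- s M) `|x i|) @[M --> \oo] --> S' ->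
  sums_to x S.
Proof.
move=> us smono sex xS xS'; have FF : ProperFilter (@totally I) := totally_filter.
apply/cvgrPdist_lt => e e0.
have e2 : 0 < e / 2 by rewrite divr_gt0.
have e4 : 0 < e / 4 by rewrite divr_gt0.
move/cvgrPdist_lt/(_ _ e2): xS => [M1 _ hM1].
move/cvgrPdist_lt/(_ _ e4): xS' => [M2 _ hM2].
pose M := maxn M1 M2.
exists [fset i in s M]%fset => // A /= /fsubsetP BA.
have [M' MM' AM'] : exists2 M', (M <= M')%N & {subset enum_fset A <= s M'}.
  elim: (enum_fset A) => [|i l [N MN hN]]; first by exists M.
  have [N' iN'] := sex i; exists (maxn N N'); first by rewrite leq_max MN.
  move=> j; rewrite inE => /predU1P[->|/hN].
    by apply: smono iN'; rewrite leq_maxr.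
  by apply: smono; rewrite leq_maxl.
rewrite partial_sumE -(subrK (\sum_(i <- s M) x i) S) -addrA.
apply: le_lt_trans (ler_normD _ _) _; rewrite (splitr e).
apply: ltr_leD.
  by apply: hM1; exact: leq_maxl.
have sA : {subset s M <= enum_fset A}.
  by move=> i iM; apply: BA; rewrite in_fset.
have D := ler_norm_sum_diff x (us M) (fset_uniq A) (us M') sA AM'.
rewrite distrC; apply: (le_trans D); rewrite -(ger0_norm (le_trans (normr_ge0 _) D)).
rewrite distrC -(subrK S' (\sum_(i <- s M) `|x i|)) -addrA.
apply: le_trans (ler_normD _ _) _.
have -> : e / 2 = e / 4 + e / 4 by field.
rewrite lerD // ltW //.
  by rewrite distrC; apply: hM2; exact: leq_maxr.
by apply: hM2; rewrite /= (leq_trans (leq_maxr _ _) MM').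
Qed.

End UnorderedSum.

(** * Dominated convergence and infinite products *)

(* The only form of completeness of the complex numbers that is used; it lets
   the limits be taken in an arbitrary numFieldType. *)
Definition geometrically_complete (K : numFieldType) : Prop :=
  forall (u : nat -> K) (c x : K), 0 <= x < 1 ->
    (forall n, `|u n| <= c * x ^+ n) -> cvgn (series u).

Section GeometricallyComplete.
Variables (K : numFieldType) (hK : geometrically_complete K).

(** In a non-Archimedean field x < 1 does not force x^n -> 0; here the powers are the terms of a
    series that converges by [hK]. *)
Lemma geometric_cvg0 (c x : K) : 0 <= x < 1 -> c * x ^+ n @[n --> \oo] --> 0.
Proof.
move=> x01; apply: cvg_series_cvg_0; apply: (hK (c := `|c|) x01) => n.
by rewrite normrM normrX (ger0_norm (andP x01).1).
Qed.

Lemma geometric_tail (c x : K) k M : 0 <= c -> 0 <= x < 1 ->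
  \sum_(k <= n < M) c * x ^+ n <= c * x ^+ k / (1 - x).
Proof.
move=> c0 /andP[x0 x1]; have x1' : 0 < 1 - x by rewrite subr_gt0.
have [kM|Mk] := leqP k M; last first.
  rewrite big_geq ?(ltnW Mk) //.
  by rewrite divr_ge0 ?mulr_ge0 ?exprn_ge0 // ltW.
rewrite ler_pdivlMr // mulr_suml (_ : \sum_(_ <= _ < _) _ =
  \sum_(k <= n < M) (c * x ^+ n - c * x ^+ n.+1)); last first.
  by apply: eq_bigr => n _; rewrite exprS; ring.
rewrite -(opprK (\sum_(_ <= _ < _) _)) -sumrN.
under eq_bigr do rewrite opprB.
by rewrite telescope_sumr // opprB gerBl mulr_ge0 // exprn_ge0.
Qed.

(** The sum is cut at a k with c x^k / (1 - x) < e/2: the tail is small uniformly in M, and the head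
    is a fixed finite sum of null sequences. *)
Lemma tannery0 (f : nat -> nat -> K) (c x : K) : 0 <= x < 1 ->
  (forall M n, (n < M)%N -> `|f M n| <= c * x ^+ n) ->
  (forall n, f M n @[M --> \oo] --> 0) ->
  \sum_(0 <= n < M) f M n @[M --> \oo] --> 0.
Proof.
move=> x01 fle f0; have c0 : 0 <= c.
  by have := fle 1%N 0%N isT;
    rewrite expr0 mulr1; apply: le_trans (normr_ge0 _).
apply/cvgrPdist_lt => e e0; have e2 : 0 < e / 2 by rewrite divr_gt0.
have /cvgrPdist_lt/(_ _ e2)[k _ /(_ k (leqnn k))] := @geometric_cvg0 (c / (1 - x)) x x01.
rewrite /= sub0r normrN mulrAC => hk.
have : \sum_(0 <= n < k) f M n @[M --> \oo] --> 0.
  elim: k {hk} => [|k IH]; first by under eq_fun do rewrite big_geq //; exact: cvg_cst.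
  under eq_fun do rewrite big_nat_recr //=.
  by have h := cvgD IH (f0 k); rewrite addr0 in h; exact: h.
move/cvgrPdist_lt/(_ _ e2) => [N _ hN].
exists (maxn k N) => // M /=; rewrite geq_max => /andP[kM NM].
rewrite (big_cat_nat (n := k)) //= opprD addrA (splitr e).
apply: le_lt_trans (ler_normD _ _) _; apply: ltr_leD; first exact: hN.
rewrite normrN; apply: le_trans (ler_norm_sum _ _ _) _.
apply: le_trans (_ : \sum_(k <= n < M) c * x ^+ n <= _).
  by apply: ler_sum_nat => n /andP[_ nM]; exact: fle.
apply: le_trans (geometric_tail _ _ c0 x01) _; apply: le_trans (ltW hk).
by apply: real_ler_norm; rewrite ger0_real // divr_ge0 ?mulr_ge0 ?exprn_ge0 ?subr_ge0 //;
  case/andP: x01 => // _ /ltW.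
Qed.

(** Replacing [b M n] by [b M n - l] reduces to limit 0, with dominating constant c (C + |l|). *)
Lemma tannery (t : nat -> K) (b : nat -> nat -> K) (c x C l S : K) :
  0 <= x < 1 -> (forall n, `|t n| <= c * x ^+ n) ->
  (forall M n, (n < M)%N -> `|b M n| <= C) ->
  (forall n, b M n @[M --> \oo] --> l) ->
  series t @ \oo --> S ->
  \sum_(0 <= n < M) t n * b M n @[M --> \oo] --> S * l.
Proof.
move=> x01 ht hb bl tS.
have c0 : 0 <= c by have := ht 0%N;
    rewrite expr0 mulr1; apply: le_trans (normr_ge0 _).
have -> : (fun M => \sum_(0 <= n < M) t n * b M n) =
    (fun M => \sum_(0 <= n < M) t n * (b M n - l) + series t M * l).
  apply/funext => M; rewrite /series /= mulr_suml -big_split /=.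
  by apply: eq_bigr => n _; ring.
rewrite -[S * l]add0r; apply: cvgD; last by apply: cvgM => //; exact: cvg_cst.
apply: (@tannery0 _ (c * (C + `|l|)) x) => // [M n nM|n].
  rewrite normrM (mulrAC c) ler_pM //.
  by apply: le_trans (ler_normB _ _) _; rewrite lerD2r hb.
rewrite -(mulr0 (t n)); apply: cvgM; first exact: cvg_cst.
by rewrite -(subrr l); apply: cvgB => //; exact: cvg_cst.
Qed.

Lemma cvgn_bounded (u : nat -> K) : cvgn u -> exists C, forall n, `|u n| <= C.
Proof.
move=> /cvg_ex[l /cvgrPdist_lt/(_ 1 ltr01)[N _ hN]].
exists (\sum_(i < N) `|u i| + (`|l| + 1)) => n.
have S0 : 0 <= \sum_(i < N) `|u i| by apply: sumr_ge0.
have [nN|Nn] := ltnP n N.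
  rewrite (bigD1 (Ordinal nN)) //= -!addrA lerDl.
  by rewrite !addr_ge0 ?sumr_ge0.
rewrite -[leLHS]add0r lerD // -(subKr l (u n)).
by rewrite (le_trans (ler_normB _ _)) // lerD2l ltW //; apply: hN.
Qed.

(** The partial products telescope into a series of increments [u n * a n]. Since |[u n]| grows at
    most like (1 + d)^n, these are O(((1 + d) x)^n), and [hK] applies. *)
Lemma prod_cvg (a : nat -> K) (c x : K) : 0 <= x < 1 ->
  (forall n, `|a n| <= c * x ^+ n) ->
  cvgn (fun N => \prod_(i < N) (1 + a i)).
Proof.
move=> x01 ha; have /andP[x0 x1] := x01.
have c0 : 0 <= c by have := ha 0%N;
    rewrite expr0 mulr1; apply: le_trans (normr_ge0 _).
set u := fun N => _.
have uS N : u N.+1 = u N * (1 + a N) by rewrite /u big_ord_recr.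
(* Chosen so that (1 + d) x <= x + d = 1 - d < 1. *)
pose d := (1 - x) / 2.
have d0 : 0 < d by rewrite divr_gt0 // subr_gt0.
have [k hk] : exists k, forall n, (k <= n)%N -> c * x ^+ n <= d.
  have /cvgrPdist_lt/(_ _ d0)[k _ h] := @geometric_cvg0 c x x01.
  exists k => n /h /=; rewrite sub0r normrN ger0_norm ?mulr_ge0 ?exprn_ge0 //.
  exact: ltW.
pose v N := \prod_(i < N) (1 + c * x ^+ i).
have v1 N : 1 <= v N.
  rewrite /v; elim/big_ind: _ => // [y z|i _]; first exact: mulr_ege1.
  by rewrite lerDl mulr_ge0 ?exprn_ge0.
have vS N : v N.+1 = v N * (1 + c * x ^+ N) by rewrite /v big_ord_recr.
have uv N : `|u N| <= v N.
  rewrite /u normr_prod; apply: ler_prod => i _; rewrite normr_ge0.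
  by apply: le_trans (ler_normD _ _) _; rewrite normr1 lerD2l.
have d1 : 1 <= 1 + d by rewrite lerDl ltW.
have vle N : v N <= v k * (1 + d) ^+ N.
  have [Nk|kN] := leqP N k.
    apply: (@le_trans _ _ (v k)); last first.
      by rewrite ler_peMr ?exprn_ege1 // (le_trans ler01).
    rewrite -(subnK Nk); elim: (k - N)%N => // m IH; rewrite addSn vS.
    apply: le_trans IH _.
    by rewrite ler_peMr ?(le_trans ler01) // lerDl mulr_ge0 ?exprn_ge0.
  rewrite -(subnK (ltnW kN)); elim: (N - k)%N => [|m IH].
    by rewrite ler_peMr ?exprn_ege1 // (le_trans ler01).
  rewrite addSn vS exprSr mulrA; apply: ler_pM => //.
  - by rewrite (le_trans ler01).
  - by rewrite addr_ge0 // mulr_ge0 ?exprn_ge0.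
  - by rewrite lerD2l hk // leq_addl.
pose y := (1 + d) * x.
have y01 : 0 <= y < 1.
  rewrite (mulr_ge0 (le_trans ler01 d1) x0) /=.
  apply: (@le_lt_trans _ _ (x + d)).
    by rewrite /y mulrDl mul1r lerD2l ler_piMr // ltW.
  have -> : x + d = 1 - d by rewrite /d; field.
  by rewrite ltrBlDr ltrDl.
have /(hK y01) sc : forall n, `|u n.+1 - u n| <= (v k * c) * y ^+ n.
  move=> n; rewrite uS mulrDr mulr1 addrC addKr normrM.
  rewrite exprMn mulrACA; apply: ler_pM => //.
  exact: le_trans (vle n).
have -> : u = (fun N => u 0%N + series (fun n => u n.+1 - u n) N).
  apply/funext => N; rewrite /series /= telescope_sumr //.
  by rewrite addrC subrK.
by apply: is_cvgD => //; exact: is_cvg_cst.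
Qed.

Lemma one_minus_geometric_gap (a p : K) n : `|p| < 1 ->
  1 - `|a| <= `|1 - a * p ^+ n|.
Proof.
move=> p1; apply: le_trans (lerB_normD _ _); rewrite normr1 lerD2l lerN2.
rewrite normrN normrM normrX ler_piMr // exprn_ile1 //; exact: ltW.
Qed.

Lemma one_minus_geometric_neq0 (a p : K) n : `|a| < 1 -> `|p| < 1 ->
  1 - a * p ^+ n != 0.
Proof.
move=> a1 p1; rewrite -normr_gt0.
by apply: lt_le_trans (one_minus_geometric_gap _ _ p1); rewrite subr_gt0.
Qed.

(** The limit is nonzero because the product of the inverses 1 + a p^i / (1 - a p^i) converges as
    well, and the two limits multiply to 1. *)
Lemma qpoch_cvg (a p : K) : `|a| < 1 -> `|p| < 1 ->
  exists2 l, l != 0 & qpoch a p @ \oo --> l.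
Proof.
move=> a1 p1; have p01 : 0 <= `|p| < 1 by rewrite normr_ge0.
have ha n : `|- (a * p ^+ n)| <= `|a| * `|p| ^+ n.
  by rewrite normrN normrM normrX.
have /cvg_ex[l ul] := prod_cvg p01 ha.
exists l => //.
have nz n := one_minus_geometric_neq0 n a1 p1.
have hb n : `|a * p ^+ n / (1 - a * p ^+ n)| <= `|a| / (1 - `|a|) * `|p| ^+ n.
  rewrite normrM normfV normrM normrX mulrAC.
  rewrite ler_wpM2r ?exprn_ge0 // ler_wpM2l //.
  by rewrite lef_pV2 ?posrE ?one_minus_geometric_gap ?subr_gt0 ?normr_gt0.
have /cvg_ex[m um] := prod_cvg p01 hb.
have : 1 @[N --> \oo] --> l * m.
  have -> : (fun _ : nat => 1 : K) = qpoch a p \*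
      (fun N => \prod_(i < N) (1 + a * p ^+ i / (1 - a * p ^+ i))).
    apply/funext => N; rewrite /= /qpoch -big_split big1 // => i _ /=.
    by field.
  exact: cvgM.
move=> /(cvg_unique (@norm_hausdorff _ K)) /(_ (@cvg_cst _ _ _ _ _)) lm.
by apply: contra_eq_neq lm => ->; rewrite mul0r eq_sym oner_eq0.
Qed.

End GeometricallyComplete.

(** * The two sums *)

Section LebesgueSeries.
Variables (K : numFieldType) (hK : geometrically_complete K).
Implicit Types a q s : K.

(** The parameter [a] is separate from [q]: [a = q] gives the series of the theorem, and a = -s q
    the P4 sum with sign variable s. *)
Definition lebesgue_term a q n : K :=
  qpoch a (q ^+ 2) n * q ^+ (n ^ 2) / qpoch (q ^+ 4) (q ^+ 4) n.

Lemma normX_lt1 q n : `|q| < 1 -> `|q ^+ n.+1| < 1.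
Proof. by move=> q1; rewrite normrX exprn_ilt1. Qed.

(** Both q-Pochhammer factors are bounded, being convergent with nonzero limit below the bar, and n
    <= n^2. *)
Lemma lebesgue_term_bound a q : `|a| < 1 -> `|q| < 1 ->
  exists c, forall n, `|lebesgue_term a q n| <= c * `|q| ^+ n.
Proof.
move=> a1 q1.
have [l l0 al] := qpoch_cvg hK a1 (normX_lt1 1 q1).
have [d d0 dl] := qpoch_cvg hK (normX_lt1 3 q1) (normX_lt1 3 q1).
have [C1 h1] := cvgn_bounded (cvgP _ al).
have [C2 h2] := cvgn_bounded (cvgP _ (cvgV d0 dl)).
exists (C1 * C2) => n; rewrite /lebesgue_term mulrAC normrM.
rewrite ler_pM ?normr_ge0 //; first by rewrite normrM ler_pM //; exact: h2.
rewrite normrX; apply: ler_wiXn2l => //; first exact: ltW.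
by nia.
Qed.

Lemma qpoch_inf_cvg a q : `|a| < 1 -> `|q| < 1 ->
  qpoch_inf a q != 0 /\ qpoch a q @ \oo --> qpoch_inf a q.
Proof.
move=> a1 q1; have [l l0 al] := qpoch_cvg hK a1 q1.
by rewrite /qpoch_inf (cvg_lim (@norm_hausdorff _ K) al).
Qed.

Lemma lebesgue_identity q : `|q| < 1 ->
  series (lebesgue_term q q) @ \oo -->
    qpoch_inf (q ^+ 2) (q ^+ 4) ^+ 2 / qpoch_inf q (q ^+ 2).
Proof.
move=> q1.
have q2 := normX_lt1 1 q1; have q4 := normX_lt1 3 q1.
have [A0 A] := qpoch_inf_cvg q2 q4; have [B0 B] := qpoch_inf_cvg q1 q2.
have [D0 D] := qpoch_inf_cvg q4 q4; have [P0 P] := qpoch_inf_cvg q2 q2.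
set Al := qpoch_inf (q ^+ 2) (q ^+ 4) in A0 A *.
set Bl := qpoch_inf q (q ^+ 2) in B0 B *.
set Dl := qpoch_inf (q ^+ 4) (q ^+ 4) in D0 D *.
set Pl := qpoch_inf (q ^+ 2) (q ^+ 2) in P0 P *.
have q01 : 0 <= `|q| < 1 by rewrite normr_ge0.
have [c hc] := lebesgue_term_bound q1 q1.
have /cvg_ex[S hS] := hK q01 hc.
pose v n := (qpoch (q ^+ 2) (q ^+ 2) n)^-1.
have PV : v @ \oo --> Pl^-1 by exact: cvgV.
have [C hC] := cvgn_bounded (cvgP _ PV).
(* [tannery] sums over n < M and the finite identity over n <= N; with M = N + 1 this weight is 1 /
   (q^2;q^2)_(N-n). *)
pose b M n := v (M - n.+1)%N.
have bP n : b M n @[M --> \oo] --> Pl^-1.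
  by rewrite -(cvg_centern n.+1) in PV; exact: PV.
have T := tannery hK q01 hc (fun M n (_ : (n < M)%N) => hC _) bP hS.
rewrite -cvg_shiftS in T.
have qm i : 1 - q ^+ i.+1 != 0.
  by rewrite exprS; exact: one_minus_geometric_neq0.
have qp i : 1 + q ^+ i.+1 != 0.
  by rewrite exprS -(opprK q) mulNr opprK one_minus_geometric_neq0 ?opprK // normrN.
have U : \sum_(0 <= n < M.+1) lebesgue_term q q n * b M.+1 n @[M --> \oo]
    --> Al / (Bl * Dl).
  rewrite (_ : (fun M => _) = fun N => qpoch (q ^+ 2) (q ^+ 4) N /
    (qpoch q (q ^+ 2) N * qpoch (q ^+ 4) (q ^+ 4) N)).
    by apply: cvgM => //; apply: cvgV; [exact: mulf_neq0|exact: cvgM].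
  apply/funext => N; rewrite big_mkord -(lebesgue_identity_finite N qm qp).
  by apply: eq_bigr => i _; rewrite /b /v subSS.
have SE := cvg_unique (@norm_hausdorff _ K) T U.
(* The limit of [qpoch_double] along even indices; it turns S = Pl Al / (Bl Dl) into Al^2 / Bl. *)
have PE : Pl = Al * Dl.
  have h : qpoch (q ^+ 2) (q ^+ 4) \* qpoch (q ^+ 4) (q ^+ 4) @ \oo --> Al * Dl.
    exact: cvgM.
  have h' : qpoch (q ^+ 2) (q ^+ 2) \o muln 2 @ \oo --> Pl.
    by apply: cvg_comp P; exact: cvg_mulnl.
  have E : qpoch (q ^+ 2) (q ^+ 2) \o muln 2
           = qpoch (q ^+ 2) (q ^+ 4) \* qpoch (q ^+ 4) (q ^+ 4).
    by apply/funext => n /=; rewrite mul2n qpoch_double -!exprM.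
  by rewrite E in h'; exact: (cvg_unique (@norm_hausdorff _ K) h' h).
have -> : Al ^+ 2 / Bl = S; last exact: hS.
by rewrite -(mulfVK P0 S) SE PE; field; rewrite B0 D0.
Qed.

End LebesgueSeries.

(** * The sum over P4 as a limit over boxes *)

Section P4Sum.
Variables (K : numFieldType) (hK : geometrically_complete K).
Implicit Types q s : K.

Lemma expr_cvg0 q : `|q| < 1 -> q ^+ n @[n --> \oo] --> 0.
Proof.
move=> q1; apply: cvg_series_cvg_0; apply: (hK (c := 1) (x := `|q|)).
  by rewrite normr_ge0.
by move=> n; rewrite mul1r normrX.
Qed.

(** Each truncated geometric sum is (1 - Q^M) / (1 - Q) with Q = q^(4(j+1)); the numerators form the
    correction that tends to 1 with M. *)
Lemma enum4_sum_lebesgue s q M n : `|q| < 1 ->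
  \sum_(l <- enum4 M n) s ^+ even_parts l * q ^+ sumn l =
  lebesgue_term (- (s * q)) q n * \prod_(j < n) (1 - (q ^+ (4 * j.+1)) ^+ M).
Proof.
move=> q1; rewrite enum4_sum /lebesgue_term.
have h (j : nat) : 1 - q ^+ (4 * j.+1) != 0.
  by rewrite mulnS exprD exprM one_minus_geometric_neq0 // normX_lt1.
have -> : qpoch (q ^+ 4) (q ^+ 4) n = \prod_(j < n) (1 - q ^+ (4 * j.+1)).
  by apply: eq_bigr => j _; rewrite -exprS -exprM.
have -> : q ^+ (n ^ 2) = \prod_(j < n) q ^+ j.*2.+1.
  elim: n => [|n IH]; first by rewrite big_ord0.
  by rewrite big_ord_recr /= -IH -exprD; congr (_ ^+ _); nia.
rewrite /qpoch -prodfV -!big_split; apply: eq_bigr => j _ /=.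
have -> : 1 - (q ^+ (4 * j.+1)) ^+ M
    = (1 - q ^+ (4 * j.+1)) * \sum_(m < M) (q ^+ (4 * j.+1)) ^+ m.
  by rewrite -opprB subrX1 -mulNr opprB.
rewrite mulNr opprK -exprM mul2n exprS.
by field; exact: h.
Qed.

(** Dominated convergence with weight limit 1; the weights are bounded by the convergent product of
    the 1 + |q|^j. *)
Lemma box4_sum_cvg s q : `|s * q| < 1 -> `|q| < 1 ->
  \sum_(l <- box4 M) s ^+ even_parts l * q ^+ sumn l @[M --> \oo] -->
    limn (series (lebesgue_term (- (s * q)) q)).
Proof.
move=> sq1 q1; have q01 : 0 <= `|q| < 1 by rewrite normr_ge0.
have sq1' : `|- (s * q)| < 1 by rewrite normrN.
have [c hc] := lebesgue_term_bound hK sq1' q1.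
have cS := hK q01 hc.
pose b M n : K := \prod_(j < n) (1 - (q ^+ (4 * j.+1)) ^+ M).
have -> : (fun M => \sum_(l <- box4 M) s ^+ even_parts l * q ^+ sumn l) =
    (fun M => \sum_(0 <= n < M) lebesgue_term (- (s * q)) q n * b M n).
  apply/funext => M; rewrite /box4 big_flatten big_map /index_iota subn0.
  by apply: eq_bigr => n _; exact: enum4_sum_lebesgue.
rewrite -[limn _]mulr1.
have hq n : `|(`|q| ^+ n)| <= 1 * `|q| ^+ n by rewrite mul1r normrX normr_id.
have [C hC] := cvgn_bounded (prod_cvg hK q01 hq).
apply: (tannery hK q01 hc (C := C)) cS => [M n nM|n].
  apply: le_trans (hC n); rewrite /b !normr_prod.
  apply: ler_prod => j _; rewrite normr_ge0 /=.
  rewrite [leRHS]ger0_norm ?addr_ge0 ?exprn_ge0 //.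
  apply: le_trans (ler_normB _ _) _; rewrite normr1 lerD2l !normrX -exprM.
  (* The exponent 4 (j+1) M is at least j because n < M forces M > 0. *)
  by apply: ler_wiXn2l => //; [exact: ltW | nia].
elim: n => [|n IH]; first by rewrite /b; under eq_fun do rewrite big_ord0; exact: cvg_cst.
have hn : (fun M => 1 - (q ^+ (4 * n.+1)) ^+ M) @ \oo --> (1 - 0 : K).
  apply: cvgB; first exact: cvg_cst.
  by apply: expr_cvg0; rewrite mulnS add4n normX_lt1.
have := cvgM IH hn; rewrite subr0 mulr1 => h.
rewrite (_ : b^~ n.+1 = b^~ n \* (fun M => 1 - (q ^+ (4 * n.+1)) ^+ M));
  first exact: h.
by apply/funext => M; rewrite /b big_ord_recr.
Qed.

Lemma P4_sums_to q : `|q| < 1 ->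
  sums_to (fun l : {l : seq nat | P4 l} =>
             (-1) ^+ even_parts (val l) * q ^+ sumn (val l))
    (qpoch_inf (q ^+ 2) (q ^+ 4) ^+ 2 / qpoch_inf q (q ^+ 2)).
Proof.
move=> q1; rewrite -(cvg_lim (@norm_hausdorff _ K) (lebesgue_identity hK q1)).
 (* Nothing is dropped by [insub], since every member of [box4 M] lies in P4. *)
 pose s M : seq {l : seq nat | P4 l} := pmap insub (box4 M).
have memE M (l : {l : seq nat | P4 l}) : (l \in s M) = (val l \in box4 M).
  by rewrite /s mem_pmap_sub.
have sumE (F : seq nat -> K) M : \sum_(l <- s M) F (val l) = \sum_(l <- box4 M) F l.
  rewrite -(big_map val xpredT F) /s (pmap_filter (insubK _)).
  congr bigop; apply/all_filterP; apply/allP => l /(allP (box4_P4 M)) hl.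
  by rewrite insubT.
have E : q = - (-1 * q) by rewrite mulN1r opprK.
have c1 := @box4_sum_cvg (-1) q; rewrite -E in c1.
have c2 := @box4_sum_cvg 1 `|q|.
apply: (@sums_to_exhaust _ _ _ s _
  (limn (series (lebesgue_term (- (1 * `|q|)) `|q|)))).
- by move=> M; rewrite pmap_sub_uniq // box4_uniq.
- by move=> M M' MM' l; rewrite !memE; exact: box4_mono.
- by move=> l; have [M h] := box4_exhaust (valP l); exists M; rewrite memE.
- under eq_fun do rewrite (sumE (fun l => (-1) ^+ even_parts l * q ^+ sumn l)).
  by apply: c1 => //; rewrite mulN1r normrN.
- under eq_fun do rewrite (sumE (fun l => `|(-1) ^+ even_parts l * q ^+ sumn l|)).
  under eq_fun do under eq_bigr do rewrite normrM normrX normrN1 normrX.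
  by apply: c2; rewrite ?mul1r normr_id.
Qed.

End P4Sum.

(** * Geometric completeness of the complex numbers *)

Lemma cvgn_eps (K : numFieldType) (u : nat -> K) (l : K) :
  (forall e, 0 < e -> exists N, forall n, (N <= n)%N -> `|l - u n| < e) -> cvgn u.
Proof.
move=> h; apply: (@cvgP _ _ l); apply/cvgrPdist_lt => e /h[N hN].
by exists N.
Qed.

Local Open Scope complex_scope.
Section Complex.
Variable R : realType.
Local Open Scope complex_scope.
Implicit Type z : R[i].

Lemma normc_realC (x : R) : `|x%:C| = `|x|%:C.
Proof. by rewrite normc_def /= expr0n /= addr0 sqrtr_sqr. Qed.

Lemma normc_i : `|'i%C : R[i]| = 1.
Proof. by rewrite normc_def /= expr0n /= add0r expr1n sqrtr1. Qed.

Lemma normc_ge_ReIm z : `|complex.Re z|%:C <= `|z| /\ `|complex.Im z|%:C <= `|z|.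
Proof.
split; first exact: normc_ge_Re.
rewrite normc_def lecR -sqrtr_sqr ler_wsqrtr //.
by rewrite lerDr sqr_ge0.
Qed.

(** Real and imaginary parts are dominated by a real geometric series, so both series converge
    absolutely; their limits are recombined. *)
Lemma complex_geometrically_complete : geometrically_complete R[i].
Proof.
move=> u c x /andP[x0 x1] hu.
have c0 : 0 <= c.
  by have := hu 0%N;
    rewrite expr0 mulr1; apply: le_trans (normr_ge0 _).
(* A nonnegative element of [R[i]] is real, so the bounds descend to [R]; the same is done with [e]
   below. *)
have cE := RRe_real (ger0_real c0); have xE := RRe_real (ger0_real x0).
set c' := complex.Re c in cE; set x' := complex.Re x in xE.
rewrite -xE in x0 x1 hu; rewrite -cE in c0 hu.
rewrite ler0c in x0; rewrite ler0c in c0.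
have x1' : x' < 1 by rewrite -ltcR.
have part (f : R[i] -> R) : (forall z, `|f z|%:C <= `|z|) ->
    cvgn (series (f \o u)).
  move=> hf; apply: normed_cvg; rewrite /normed_series_of /=.
  apply: (series_le_cvg (v_ := geometric c' x')) => [n|n|n|] //=.
  - by rewrite mulr_ge0 ?exprn_ge0.
  - rewrite -lecR; apply: le_trans (hf _) _; apply: le_trans (hu n) _.
    by rewrite rmorphM rmorphXn.
  - by apply: is_cvg_geometric_series; rewrite ger0_norm.
have /cvg_ex[a ha] := part _ (fun z => (normc_ge_ReIm z).1).
have /cvg_ex[b hb] := part _ (fun z => (normc_ge_ReIm z).2).
apply: (@cvgn_eps _ _ (a%:C + 'i%C * b%:C)) => e e0.
have eE := RRe_real (ger0_real (ltW e0)); rewrite -eE in e0 *.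
set e' := complex.Re e in e0 *; rewrite ltcR in e0.
have e2 : 0 < e' / 2 by rewrite divr_gt0.
move/cvgrPdist_lt/(_ _ e2): ha => [N1 _ h1].
move/cvgrPdist_lt/(_ _ e2): hb => [N2 _ h2].
exists (maxn N1 N2) => n; rewrite geq_max => /andP[/h1 /= {}h1 /h2 /= {}h2].
have -> : series u n = (series (complex.Re (R:=R) \o u) n)%:C
                     + 'i%C * (series (complex.Im (R:=R) \o u) n)%:C.
  rewrite /series /= !rmorph_sum mulr_sumr -big_split /=.
  by apply: eq_bigr => k _; rewrite -complexE.
rewrite opprD addrACA -mulrBr -!rmorphB /=.
apply: le_lt_trans (ler_normD _ _) _.
rewrite normrM normc_i mul1r !normc_realC -rmorphD ltcR (splitr e').
exact: ltrD.
Qed.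
End Complex.

Theorem theorem3p6 (R : realType) (q : R[i]) (hq : `|q| < 1) :
  let rhs := qpoch_inf (q ^+ 2) (q ^+ 4) ^+ 2 / qpoch_inf q (q ^+ 2) in
  sums_to (fun l : {l : seq nat | P4 l} =>
             (-1) ^+ even_parts (val l) * q ^+ sumn (val l)) rhs
  /\ series_to (fun n => qpoch q (q ^+ 2) n * q ^+ (n ^ 2)
                         / qpoch (q ^+ 4) (q ^+ 4) n) rhs.
Proof.
move=> rhs; have hK := @complex_geometrically_complete R.
by split; [exact: P4_sums_to|exact: lebesgue_identity].
Qed.
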